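(* Let $p\ge1$, $a\in\mathbb{R}^{p\times p}$, $b\in\mathbb{R}^p$, $\Sigma\in\mathbb{R}^{p\times p}$ non-singular, $\alpha_1\in\mathbb{R}$, and $\beta_1$ a nonzero $p$-dimensional row vector. Let $(X,W)$, with $W$ a $p$-dimensional Brownian motion, be a solution on some filtered probability space $(\Omega,\mathcal{F},(\mathcal{F}_t),\mathbb{P})$ of $$dX_t=(aX_t+b)\,dt+\Sigma\sqrt{|V_{1,t}|}\,dW_t,\qquad V_{1,t}=\alpha_1+\beta_1X_t,$$ with deterministic initial value $X_0=x_0$ satisfying $\alpha_1+\beta_1x_0\ge0$. Then there exists an affine transformation $\widetilde X=KX+\ell$ of $X$ ($K\in\mathbb{R}^{p\times p}$, $\ell\in\mathbb{R}^p$), together with $\widetilde a\in\mathbb{R}^{p\times p}$ and $\widetilde b\in\mathbb{R}^p$, such that $$d\widetilde X_t=(\widetilde a\widetilde X_t+\widetilde b)\,dt+\sqrt{|\widetilde X_{1,t}|}\,d\widetilde W_t,$$ where $\widetilde W$ is an orthogonal transformation of $W$ (hence also a Brownian motion). Moreover, $\widetilde X_{1,t}=cV_{1,t}$ for some constant $c>0$. In addition, one can take $\widetilde a_{1j}\ge0$ for all $j\ne1$.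
   Context: Here $\sqrt{|V_{1,t}|}$ and $\sqrt{|\widetilde X_{1,t}|}$ are scalars multiplying vectors; $\widetilde X_{1,t}$ is the first coordinate of $\widetilde X_t$. An orthogonal transformation of $W$ is a process $UW$ with $U\in\mathbb{R}^{p\times p}$ an orthogonal matrix. *)

(* Defs.v *)
From HB Require Import structures.
From mathcomp Require Import all_boot all_order all_algebra.
From mathcomp Require Import all_classical all_reals all_analysis.

Set Implicit Arguments.
Unset Strict Implicit.
Unset Printing Implicit Defensive.

Import Order.TTheory GRing.Theory Num.Theory.
Import numFieldNormedType.Exports.

Local Open Scope classical_set_scope.
Local Open Scope ring_scope.

(* A process is a function Y : R -> Omega -> 'M[R]_(m, n); only its values at
   times t >= 0 are ever constrained. *)

Section StochasticCalculus.
Context (d : measure_display) (Omega : measurableType d) (R : realType).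
Implicit Types (P : probability Omega R) (F : R -> set (set Omega)).

(* Frobenius norm; on column vectors, the Euclidean norm. *)
Definition fnorm m n (A : 'M[R]_(m, n)) : R :=
  Num.sqrt (\sum_i \sum_j A i j ^+ 2).

Definition filtration F : Prop :=
  [/\ forall t, 0 <= t -> sigma_algebra setT (F t),
      forall t, 0 <= t -> F t `<=` measurable
    & forall s t, 0 <= s -> s <= t -> F s `<=` F t].

(* The sigma-algebra on Omega generated by a random vector. *)
Definition sigma_rv m (Y : Omega -> 'cV[R]_m) : set (set Omega) :=
  g_sigma_preimage (fun i w => Y w i 0).

Definition adapted F m (Y : R -> Omega -> 'cV[R]_m) : Prop :=
  forall t, 0 <= t -> sigma_rv (Y t) `<=` F t.

Definition continuous_paths m (Y : R -> Omega -> 'cV[R]_m) : Prop :=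
  forall w i, {within `[0, +oo[, continuous (fun t => Y t w i 0)}.

(* Standard m-dimensional Brownian motion relative to F.  The law N(0, (t-s) I)
   of an increment is the usual one of a Gaussian vector: every linear
   combination of its coordinates is Gaussian with the right variance.
   The cases s = t and u = 0 are left out because [normal_prob m 0] is not the
   Dirac mass at m; there the combination is identically 0 anyway. *)
Definition brownian_motion P F m (W : R -> Omega -> 'cV[R]_m) : Prop :=
  [/\ adapted F W,
      continuous_paths W,
      {ae P, forall w, W 0 w = 0},
      forall s t, 0 <= s -> s < t ->
        forall A B, F s A -> sigma_rv (fun w => W t w - W s w) B ->
          P (A `&` B) = (P A * P B)%E
    & forall s t (u : 'rV[R]_m), 0 <= s -> s < t -> u != 0 ->
        forall B : set R, measurable B ->
          P ((fun w => (u *m (W t w - W s w)) 0 0) @^-1` B) =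
          normal_prob 0 (Num.sqrt (t - s) * fnorm u) B].

(* The simple process  \sum_(k < size) value k * 1_(time k, time k.+1]. *)
Record simple_process m n := SimpleProcess {
  sp_size : nat;
  sp_time : nat -> R;
  sp_value : nat -> Omega -> 'M[R]_(m, n) }.

Definition predictable_simple F m n (H : simple_process m n) : Prop :=
  [/\ 0 <= sp_time H 0,
      forall k, (k < sp_size H)%N -> sp_time H k <= sp_time H k.+1,
      forall k i j, (k < sp_size H)%N ->
        preimage_set_system setT (fun w => sp_value H k w i j) measurable
          `<=` F (sp_time H k)
    & exists C : R, forall k w, (k < sp_size H)%N -> fnorm (sp_value H k w) <= C].

Definition sp_eval m n (H : simple_process m n) (t : R) (w : Omega)
    : 'M[R]_(m, n) :=
  \sum_(k < sp_size H)
    (if (sp_time H k < t) && (t <= sp_time H k.+1) then sp_value H k w else 0).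

Definition sp_integral m n (H : simple_process m n)
    (W : R -> Omega -> 'cV[R]_n) (t : R) (w : Omega) : 'cV[R]_m :=
  \sum_(k < sp_size H)
    sp_value H k w *m (W (Num.min t (sp_time H k.+1)) w
                       - W (Num.min t (sp_time H k)) w).

(* Convergence to 0 in probability of nonnegative extended-real variables.
   The outer measure P^* agrees with P on measurable sets; using it keeps
   measurability of the Z k out of the definition. *)
Definition cvg0_in_probability P (Z : nat -> Omega -> \bar R) : Prop :=
  forall e : R, 0 < e ->
    (P^*)%mu [set w | (e%:E <= Z k w)%E] @[k --> \oo] --> 0%E.

(* J is the Ito integral process \int_0^. H dW: simple processes converge to H
   in L^2([0, tau]) in probability and their elementary integrals converge to
   J uniformly on [0, tau] in probability, for every horizon tau.
   W is a Brownian motion relative to F; J is then unique up to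
   indistinguishability. *)
Definition ito_integral P F m n (H : R -> Omega -> 'M[R]_(m, n))
    (W : R -> Omega -> 'cV[R]_n) (J : R -> Omega -> 'cV[R]_m) : Prop :=
  exists S : nat -> simple_process m n,
    (forall k, predictable_simple F (S k)) /\
    forall tau : R, 0 < tau ->
      cvg0_in_probability P (fun k w =>
        \int[lebesgue_measure]_(s in `[0%R, tau])
          ((fnorm (sp_eval (S k) s w - H s w) ^+ 2)%R)%:E)%E /\
      cvg0_in_probability P (fun k w =>
        ereal_sup [set (fnorm (sp_integral (S k) W t w - J t w))%:E
                  | t in `[0, tau]]).

(* dX = mu(X) dt + sigma(X) dW, in integral form. *)
Definition sde_solution P F m n (mu : 'cV[R]_m -> 'cV[R]_m)
    (sigma : 'cV[R]_m -> 'M[R]_(m, n))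
    (X : R -> Omega -> 'cV[R]_m) (W : R -> Omega -> 'cV[R]_n) : Prop :=
  [/\ brownian_motion P F W,
      adapted F X,
      continuous_paths X
    & exists2 J : R -> Omega -> 'cV[R]_m,
        ito_integral P F (fun t w => sigma (X t w)) W J
      & {ae P, forall w, forall t : R, 0 <= t ->
          X t w = X 0 w
            + \col_i (\int[lebesgue_measure]_(s in `[0%R, t]) (mu (X s w)) i 0)%R
            + J t w}].

End StochasticCalculus.

(* Main.v *)
(* The process [K X + l] has diffusion coefficient [sqrt `|c V| *: 1] with
   respect to [U W] as soon as [K Sigma = sqrt c U]; its first coordinate is then
   [c V], for a suitable [l], exactly when the first row of [U] is
   [sqrt c beta1 Sigma].  Hence [c = 1 / |beta1 Sigma|^2], and [U] is any
   orthogonal completion of the unit vector along [beta1 Sigma].  Negating rows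
   of [U] other than the first makes the off-diagonal entries of the first row of
   the new drift matrix nonnegative.  The stochastic integral is transported by
   replacing each approximating simple process [S] with [K S U^T]. *)

Require Import Defs.
From HB Require Import structures.
From mathcomp Require Import all_boot all_order all_algebra.
From mathcomp Require Import all_classical all_reals all_analysis.
From mathcomp Require Import ring.

Set Implicit Arguments.
Unset Strict Implicit.
Unset Printing Implicit Defensive.

Import Order.TTheory GRing.Theory Num.Theory.
Import numFieldNormedType.Exports.

Local Open Scope classical_set_scope.
Local Open Scope ring_scope.

(** * Frobenius norm: orthogonal invariance and boundedness of linear maps *)

Lemma fnorm_ge0 (R : realType) m n (A : 'M[R]_(m, n)) : 0 <= fnorm A.
Proof. exact: sqrtr_ge0. Qed.

Lemma fnorm_sqr (R : realType) m n (A : 'M[R]_(m, n)) :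
  fnorm A ^+ 2 = \sum_i \sum_j A i j ^+ 2.
Proof.
by rewrite sqr_sqrtr //; apply: sumr_ge0 => i _; apply: sumr_ge0 => j _; exact: sqr_ge0.
Qed.

Lemma fnorm_row_sqr (R : realType) n (u : 'rV[R]_n) :
  fnorm u ^+ 2 = (u *m u^T) 0 0.
Proof.
rewrite fnorm_sqr big_ord1 mxE.
by apply: eq_bigr => j _; rewrite !mxE expr2.
Qed.

Lemma fnorm_row_gt0 (R : realType) n (u : 'rV[R]_n) : u != 0 -> 0 < fnorm u.
Proof.
move=> u0; rewrite lt_neqAle fnorm_ge0 andbT eq_sym.
apply: contraNneq u0 => nu0; have := fnorm_sqr u.
rewrite nu0 expr0n big_ord1 => /esym/eqP.
rewrite psumr_eq0 => [/allP u0|j _]; last exact: sqr_ge0.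
apply/eqP/rowP => j; rewrite mxE.
by have := u0 j (mem_index_enum _); rewrite /= sqrf_eq0 => /eqP.
Qed.

Lemma fnorm_row_orthogonal (R : realType) n (u : 'rV[R]_n) (U : 'M[R]_n) :
  U *m U^T = 1%:M -> fnorm (u *m U) = fnorm u.
Proof.
move=> UU; apply/eqP; rewrite -(@eqrXn2 _ 2) ?fnorm_ge0 //.
by rewrite !fnorm_row_sqr trmx_mul mulmxA -(mulmxA u) UU mulmx1.
Qed.

Lemma fnorm_entry_le (R : realType) m n (A : 'M[R]_(m, n)) i j :
  `|A i j| <= fnorm A.
Proof.
rewrite -sqrtr_sqr ler_wsqrtr // (bigD1 i) //= (bigD1 j) //= -addrA lerDl addr_ge0 //.
  by apply: sumr_ge0 => k _; exact: sqr_ge0.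
by apply: sumr_ge0 => k _; apply: sumr_ge0 => l _; exact: sqr_ge0.
Qed.

Lemma fnorm_le_sum (R : realType) m n (A : 'M[R]_(m, n)) :
  fnorm A <= \sum_i \sum_j `|A i j|.
Proof.
have s0 : 0 <= \sum_i \sum_j `|A i j| by apply: sumr_ge0 => i _; exact: sumr_ge0.
rewrite -(ler_pXn2r (n := 2)) ?nnegrE ?fnorm_ge0 // fnorm_sqr !pair_bigA /=.
rewrite [leRHS]expr2 mulr_suml; apply: ler_sum => k _.
rewrite -real_normK ?num_real // expr2 ler_wpM2l //.
by rewrite (bigD1 k) //= lerDl sumr_ge0.
Qed.

(** Expand the entries of the product and bound each entry of [A] by [fnorm A]. Adding 1 to the
    resulting sum keeps the constant positive even if [K] or [L] vanishes, so that it can be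
    inverted in the convergence estimates. *)
Lemma fnorm_mulmx_bounded (R : realType) m n m' n'
    (K : 'M[R]_(m', m)) (L : 'M[R]_(n, n')) :
  exists2 C, 0 < C & forall A : 'M[R]_(m, n), fnorm (K *m A *m L) <= C * fnorm A.
Proof.
pose S := \sum_i \sum_j \sum_l \sum_k `|K i k| * `|L l j|.
have S0 : 0 <= S.
  by do 4! (apply: sumr_ge0 => ? _); rewrite mulr_ge0.
exists (1 + S); first by rewrite ltr_pwDl.
move=> A; rewrite mulrDl mul1r; apply: ler_wpDl; first exact: fnorm_ge0.
apply: le_trans (fnorm_le_sum _) _; rewrite mulr_suml; apply: ler_sum => i _.
rewrite mulr_suml; apply: ler_sum => j _.
rewrite mxE; apply: le_trans (ler_norm_sum _ _ _) _.
rewrite mulr_suml; apply: ler_sum => l _.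
rewrite mxE normrM mulr_suml.
apply: le_trans (ler_wpM2r _ (ler_norm_sum _ _ _)) _ => //.
rewrite mulr_suml; apply: ler_sum => k _.
by rewrite normrM mulrAC ler_wpM2l ?mulr_ge0 ?fnorm_entry_le.
Qed.

(** * Measurability and path continuity of affine images *)

(** Equipping [Omega] with [G] as its own measurable structure turns the claim into closure of
    measurable functions under sums and products; [sigma_algebra_id] identifies the structure
    generated by [G] with [G]. *)
Lemma preimage_sigma_algebra_sum (R : realType) d (Omega : measurableType d)
    (G : set (set Omega)) (I : finType) (c : R) (k : I -> R) (f : I -> Omega -> R) :
  sigma_algebra setT G ->
  (forall i, preimage_set_system setT (f i) measurable `<=` G) ->
  preimage_set_system setT (fun w => c + \sum_i k i * f i w) measurable `<=` G.
Proof.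
move=> sG mf; have GE := sigma_algebra_id sG.
have mfi i : measurable_fun setT (f i : g_sigma_algebraType G -> R).
  move=> _ B mB; rewrite /measurable /=.
  by rewrite GE; apply: mf; exists B.
have : measurable_fun setT
    ((fun w => c + \sum_i k i * f i w) : g_sigma_algebraType G -> R).
  apply: measurable_realfun.measurable_funD; first exact: measurable_cst.
  apply: measurable_sum => i.
  by apply: measurable_realfun.measurable_funM => //; exact: measurable_cst.
move=> mF _ [B mB <-].
by have := mF measurableT B mB; rewrite /measurable /= GE.
Qed.

Lemma sigma_rv_sub (R : realType) d (Omega : measurableType d) m
    (Y : Omega -> 'cV[R]_m) (G : set (set Omega)) : sigma_algebra setT G ->
  (forall i, preimage_set_system setT (fun w => Y w i 0) measurable `<=` G) ->
  sigma_rv Y `<=` G.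
Proof.
move=> sG YG; apply: smallest_sub => // A; rewrite -bigcup_seq.
by move=> -[i _]; exact: YG.
Qed.

Lemma sub_sigma_rv (R : realType) d (Omega : measurableType d) m
    (Y : Omega -> 'cV[R]_m) (i : 'I_m) :
  preimage_set_system setT (fun w => Y w i 0) measurable `<=` sigma_rv Y.
Proof.
move=> A YA; apply: sub_sigma_algebra.
by rewrite -bigcup_seq; exists i => //=; exact: mem_index_enum.
Qed.

(** Used twice: for adaptedness of affine images, and, with [l = 0] on increments, for independence
    of the increments of [U W]. *)
Lemma sigma_rv_affine (R : realType) d (Omega : measurableType d) m n
    (Y : Omega -> 'cV[R]_m) (K : 'M[R]_(n, m)) (l : 'cV[R]_n) :
  sigma_rv (fun w => K *m Y w + l) `<=` sigma_rv Y.
Proof.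
have sY : sigma_algebra setT (sigma_rv Y) by exact: smallest_sigma_algebra.
apply: sigma_rv_sub => // i.
under eq_fun do rewrite !mxE addrC.
apply: preimage_sigma_algebra_sum => // j; exact: sub_sigma_rv.
Qed.

Lemma within_continuous_sum (R : realType) (A : set R) (I : finType) (c : R)
    (k : I -> R) (f : I -> R -> R) :
  (forall i, {within A, continuous (f i)}) ->
  {within A, continuous (fun t => c + \sum_i k i * f i t)}.
Proof.
move=> cf t; apply: (@cvgD _ R^o); first exact: cvg_cst.
elim: (index_enum I) => [|i s IH].
  under eq_fun do rewrite big_nil.
  by rewrite big_nil; exact: cvg_cst.
under eq_fun do rewrite big_cons.
rewrite big_cons; apply: (@cvgD _ R^o) => //.
by apply: cvgM; [exact: cvg_cst | exact: cf].
Qed.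

Lemma continuous_paths_affine (R : realType) d (Omega : measurableType d) m n
    (Y : R -> Omega -> 'cV[R]_m) (K : 'M[R]_(n, m)) (l : 'cV[R]_n) :
  continuous_paths Y -> continuous_paths (fun t w => K *m Y t w + l).
Proof.
move=> cY w i.
rewrite (_ : (fun t => _) = (fun t => l i 0 + \sum_j K i j * Y t w j 0)).
  by apply: within_continuous_sum => j; exact: cY.
by apply/funext => t; rewrite !mxE addrC.
Qed.

Lemma adapted_affine (R : realType) d (Omega : measurableType d) m n
    (F : R -> set (set Omega)) (Y : R -> Omega -> 'cV[R]_m)
    (K : 'M[R]_(n, m)) (l : 'cV[R]_n) :
  adapted F Y -> adapted F (fun t w => K *m Y t w + l).
Proof. by move=> aY t t0; apply: subset_trans (aY t t0); exact: sigma_rv_affine. Qed.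

(** * Orthogonal images of Brownian motion *)

Lemma brownian_motion_orthogonal (R : realType) d (Omega : measurableType d)
    (P : probability Omega R) (F : R -> set (set Omega)) m
    (W : R -> Omega -> 'cV[R]_m) (U : 'M[R]_m) : U *m U^T = 1%:M ->
  brownian_motion P F W -> brownian_motion P F (fun t w => U *m W t w).
Proof.
move=> UU [aW cW W0 iW gW]; split.
- have -> : (fun t w => U *m W t w) = (fun t w => U *m W t w + 0).
    by apply/funext => t; apply/funext => w; rewrite addr0.
  exact: adapted_affine.
- have -> : (fun t w => U *m W t w) = (fun t w => U *m W t w + 0).
    by apply/funext => t; apply/funext => w; rewrite addr0.
  exact: continuous_paths_affine.
- by apply: filterS W0 => w /= ->; rewrite mulmx0.
- move=> s t s0 st A B FA sB; apply: (iW s t) => //.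
  apply: (@sigma_rv_affine _ _ _ _ _ _ U 0).
  by under eq_fun do rewrite mulmxBr addr0.
- move=> s t u s0 st u0 B mB.
  (* Testing [U W] against [u] is testing [W] against [u U], which has the same norm; the Gaussian
     clause also asks that [u U] be nonzero. *)
  rewrite -(fnorm_row_orthogonal u UU) -(gW s t) //.
    by under eq_fun do rewrite -mulmxBr mulmxA.
  apply: contraNneq u0 => uU0.
  by rewrite -[u]mulmx1 -UU mulmxA uU0 mul0mx.
Qed.

(** * Transport of the Ito integral by linear maps *)

(* [f] and [g] need not be measurable: the integral is a supremum over simple
   functions, which can be rescaled. *)
Lemma ge0_integral_le_scale (R : realType) d (T : measurableType d)
    (mu : {measure set T -> \bar R}) (D : set T) (f g : T -> \bar R) (C : R) :
  0 < C -> (forall x, D x -> 0 <= f x)%E -> (forall x, D x -> 0 <= g x)%E ->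
  (forall x, D x -> f x <= C%:E * g x)%E ->
  (\int[mu]_(x in D) f x <= C%:E * \int[mu]_(x in D) g x)%E.
Proof.
move=> C0 f0 g0 fg; rewrite ge0_integralE // (ge0_integralE _ g0).
apply: ge_ereal_sup => _ [h /= hf <-].
have C'0 : 0 <= C^-1 by rewrite invr_ge0 ltW.
rewrite -lee_pdivrMl // -sintegralrM; apply: ereal_sup_ubound => /=.
exists (scale_nnsfun h C'0) => // x /=.
rewrite EFinM lee_pdivrMl //; apply: le_trans (hf x) _.
rewrite !patchE; case: ifPn => [/set_mem Dx|_]; [exact: fg | by rewrite mule0].
Qed.

(** The event [e <= Z'] lies inside [e / C <= Z], and outer measure is monotone, so no measurability
    is involved. *)
Lemma cvg0_in_probability_le_scale (R : realType) d (Omega : measurableType d)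
    (P : probability Omega R) (Z Z' : nat -> Omega -> \bar R) (C : R) : 0 < C ->
  (forall k w, Z' k w <= C%:E * Z k w)%E ->
  cvg0_in_probability P Z -> cvg0_in_probability P Z'.
Proof.
move=> C0 ZZ' cZ e e0.
have /cZ : 0 < C^-1 * e by rewrite mulr_gt0 ?invr_gt0.
apply: (squeeze_cvge _ (cvg_cst 0%E)); apply: nearW => k.
rewrite outer_measure_ge0 /=; apply: le_outer_measure => w /= eZ'.
by rewrite EFinM lee_pdivrMl //; exact: le_trans (ZZ' k w).
Qed.

Definition simple_process_mulmx (R : realType) d (Omega : measurableType d)
    m n m' n' (K : 'M[R]_(m', m)) (L : 'M[R]_(n, n')) (S : simple_process Omega R m n) :
    simple_process Omega R m' n' :=
  SimpleProcess (sp_size S) (sp_time S) (fun k w => K *m sp_value S k w *m L).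

(** A filtration is a family of sigma-algebras at nonnegative times only, so the partition times
    must be located before combining measurable values. *)
Lemma sp_time_ge0 (R : realType) d (Omega : measurableType d) m n
    (F : R -> set (set Omega)) (S : simple_process Omega R m n) k :
  predictable_simple F S -> (k <= sp_size S)%N -> 0 <= sp_time S k.
Proof.
move=> [S0 Sle _ _]; elim: k => // k IH ks.
by apply: le_trans (IH (ltnW ks)) _; exact: Sle.
Qed.

Lemma predictable_simple_mulmx (R : realType) d (Omega : measurableType d)
    m n m' n' (F : R -> set (set Omega)) (K : 'M[R]_(m', m)) (L : 'M[R]_(n, n'))
    (S : simple_process Omega R m n) : filtration F ->
  predictable_simple F S -> predictable_simple F (simple_process_mulmx K L S).
Proof.
move=> [sF _ _] pS; have [S0 Sle mS [C SC]] := pS; split => //=.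
  move=> k i j ks; have sFk := sF _ (sp_time_ge0 pS (ltnW ks)).
  rewrite (_ : (fun w => _) = (fun w =>
    0 + \sum_q L q j * (0 + \sum_r K i r * sp_value S k w r q))).
    apply: preimage_sigma_algebra_sum => // q.
    by apply: preimage_sigma_algebra_sum => // r; exact: mS.
  apply/funext => w; rewrite mxE add0r; apply: eq_bigr => q _.
  by rewrite mxE add0r mulrC.
have [C' C'0 KLC'] := fnorm_mulmx_bounded K L.
exists (C' * C) => k w ks; apply: le_trans (KLC' _) _.
by rewrite ler_pM2l //; exact: SC.
Qed.

Lemma sp_eval_mulmx (R : realType) d (Omega : measurableType d)
    m n m' n' (K : 'M[R]_(m', m)) (L : 'M[R]_(n, n'))
    (S : simple_process Omega R m n) t w :
  sp_eval (simple_process_mulmx K L S) t w = K *m sp_eval S t w *m L.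
Proof.
rewrite /sp_eval mulmx_sumr mulmx_suml; apply: eq_bigr => k _ /=.
by case: ifP; rewrite // mulmx0 mul0mx.
Qed.

(** The factor [U^T] of each value cancels the [U] of the Brownian increment. *)
Lemma sp_integral_mulmx (R : realType) d (Omega : measurableType d)
    m n m' (K : 'M[R]_(m', m)) (U : 'M[R]_n)
    (S : simple_process Omega R m n) (W : R -> Omega -> 'cV[R]_n) t w :
  U *m U^T = 1%:M ->
  sp_integral (simple_process_mulmx K U^T S) (fun t w => U *m W t w) t w =
  K *m sp_integral S W t w.
Proof.
move=> /mulmx1C UU; rewrite /sp_integral mulmx_sumr; apply: eq_bigr => k _ /=.
by rewrite -mulmxBr !mulmxA -(mulmxA _ U^T) UU mulmx1.
Qed.

Lemma ito_integral_mulmx (R : realType) d (Omega : measurableType d)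
    (P : probability Omega R) (F : R -> set (set Omega)) m n m'
    (K : 'M[R]_(m', m)) (U : 'M[R]_n) (H : R -> Omega -> 'M[R]_(m, n))
    (W : R -> Omega -> 'cV[R]_n) (J : R -> Omega -> 'cV[R]_m) :
  filtration F -> U *m U^T = 1%:M -> ito_integral P F H W J ->
  ito_integral P F (fun t w => K *m H t w *m U^T) (fun t w => U *m W t w)
    (fun t w => K *m J t w).
Proof.
move=> hF UU [S [pS cS]]; exists (fun k => simple_process_mulmx K U^T (S k)).
split=> [k|tau tau0]; first exact: predictable_simple_mulmx.
have [cH cJ] := cS _ tau0; split.
  have [C C0 KC] := fnorm_mulmx_bounded K U^T.
  (* The integrand is a squared norm, hence the squared constant. *)
  apply: (@cvg0_in_probability_le_scale _ _ _ _ _ _ (C ^+ 2) _ _ cH).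
    by rewrite exprn_gt0.
  move=> k w; apply: ge0_integral_le_scale => [|s _|s _|s _].
  - by rewrite exprn_gt0.
  - by rewrite lee_fin sqr_ge0.
  - by rewrite lee_fin sqr_ge0.
  - rewrite -EFinM lee_fin -exprMn sp_eval_mulmx -mulmxBl -mulmxBr.
    by rewrite lerXn2r ?nnegrE ?mulr_ge0 ?fnorm_ge0 // ltW.
(* The integral error is a column vector, multiplied on the left only: the right factor is the 1 by
   1 identity. *)
have [C C0 KC] := fnorm_mulmx_bounded K (1%:M : 'M[R]_1).
apply: (@cvg0_in_probability_le_scale _ _ _ _ _ _ C _ _ cJ) => // k w.
apply: ge_ereal_sup => _ [t /= ht <-].
rewrite sp_integral_mulmx // -mulmxBr.
have := KC (sp_integral (S k) W t w - J t w); rewrite mulmx1 -lee_fin => /le_trans; apply.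
rewrite EFinM lee_wpmul2l ?lee_fin ?(ltW C0) //.
by apply: ereal_sup_ubound; exists t.
Qed.

(** * Affine images of solutions *)

Lemma Rintegral_mulmx (R : realType) d (T : measurableType d)
    (mu : {measure set T -> \bar R}) (D : set T) m n (K : 'M[R]_(n, m))
    (f : T -> 'cV[R]_m) : measurable D ->
  (forall i, mu.-integrable D (EFin \o (fun x => f x i 0))) ->
  \col_i (\int[mu]_(x in D) (K *m f x) i 0)%R =
  K *m \col_i (\int[mu]_(x in D) f x i 0)%R.
Proof.
move=> mD If; apply/colP => i; rewrite !mxE.
under eq_Rintegral do rewrite mxE.
under eq_bigr do rewrite mxE.
have IKf k : mu.-integrable D (EFin \o (fun x => K i k * f x k 0)).
  exact: integrableZl (If k).
elim: (index_enum _) => [|k s IH].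
  under eq_Rintegral do rewrite big_nil.
  by rewrite big_nil /Rintegral integral0.
under eq_Rintegral do rewrite big_cons.
rewrite big_cons RintegralD //; last first.
  rewrite (_ : EFin \o _ = (fun x => \sum_(l <- s) (K i l * f x l 0)%:E)%E).
    by apply: integrable_sum => // l _; exact: IKf.
  by apply/funext => x /=; rewrite sumEFin.
by rewrite IH RintegralZl.
Qed.

(** The new coefficients are compared with the old ones only on the range of the affine map, where
    the image process lives. The right factor [U^T] compensates for driving by [U W]; integrability
    of the drift lets [K] pass through the time integral. *)
Lemma sde_solution_affine (R : realType) d (Omega : measurableType d)
    (P : probability Omega R) (F : R -> set (set Omega)) m n m'
    (mu : 'cV[R]_m -> 'cV[R]_m) (sigma : 'cV[R]_m -> 'M[R]_(m, n))
    (mu' : 'cV[R]_m' -> 'cV[R]_m') (sigma' : 'cV[R]_m' -> 'M[R]_(m', n))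
    (K : 'M[R]_(m', m)) (l : 'cV[R]_m') (U : 'M[R]_n)
    (X : R -> Omega -> 'cV[R]_m) (W : R -> Omega -> 'cV[R]_n) :
  filtration F -> U *m U^T = 1%:M ->
  (forall x, mu' (K *m x + l) = K *m mu x) ->
  (forall x, sigma' (K *m x + l) = K *m sigma x *m U^T) ->
  (forall t w i, 0 <= t ->
    lebesgue_measure.-integrable `[0, t] (EFin \o (fun s => mu (X s w) i 0))) ->
  sde_solution P F mu sigma X W ->
  sde_solution P F mu' sigma' (fun t w => K *m X t w + l) (fun t w => U *m W t w).
Proof.
move=> hF UU muE sigmaE Imu [bW aX cX [J iJ XE]]; split.
- exact: brownian_motion_orthogonal.
- exact: adapted_affine.
- exact: continuous_paths_affine.
- exists (fun t w => K *m J t w).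
    rewrite (_ : (fun t w => _) = (fun t w => K *m sigma (X t w) *m U^T)).
      exact: ito_integral_mulmx.
    by apply/funext => t; apply/funext => w.
  apply: filterS XE => w XE t t0; rewrite {1}XE //.
  have -> : \col_i (\int[lebesgue_measure]_(s in `[0%R, t])
      (mu' (K *m X s w + l)) i 0)%R =
      K *m \col_i (\int[lebesgue_measure]_(s in `[0%R, t]) (mu (X s w)) i 0)%R.
    rewrite -[RHS]Rintegral_mulmx //; last by move=> i; exact: Imu.
    by apply/colP => i; rewrite !mxE; apply: eq_Rintegral => s _; rewrite muE.
  by rewrite !mulmxDr -!addrA [l + _]addrC addrA !addrA.
Qed.

(** The drift is continuous along a continuous path, and the time interval is compact. *)
Lemma affine_drift_integrable (R : realType) m (a : 'M[R]_m) (b : 'cV[R]_m)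
    (x : R -> 'cV[R]_m) (t : R) i :
  (forall j, {within `[0, +oo[, continuous (fun s => x s j 0)}) ->
  lebesgue_measure.-integrable `[0, t] (EFin \o (fun s => (a *m x s + b) i 0)).
Proof.
move=> cx; apply: continuous_compact_integrable; first exact: segment_compact.
have : {within `[0, +oo[, continuous (fun s => b i 0 + \sum_j a i j * x s j 0)}.
  exact: within_continuous_sum.
rewrite (_ : (fun s => (a *m x s + b) i 0) =
    (fun s => b i 0 + \sum_j a i j * x s j 0)); last first.
  by apply/funext => s; rewrite !mxE addrC.
apply: continuous_subspaceW.
by move=> s /=; rewrite !in_itv /= => /andP[-> _].
Qed.

(** * Orthogonal matrices with a prescribed row *)

(* The Householder reflection exchanging [u] and the basis vector [e]. *)
Lemma orthogonal_completion (R : realType) n (u : 'rV[R]_n) (i : 'I_n) :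
  fnorm u = 1 -> exists2 U : 'M[R]_n, U *m U^T = 1%:M & row i U = u.
Proof.
move=> nu; have uu : u *m u^T = 1%:M.
  by rewrite [LHS]mx11_scalar -fnorm_row_sqr nu expr1n.
pose e : 'rV[R]_n := delta_mx 0 i; pose v := u - e.
(* If [u = e] there is no reflection direction, and the identity works. *)
have [v0|v0] := eqVneq v 0.
  exists 1%:M; first by rewrite trmx1 mulmx1.
  by rewrite row1 -/e; apply/esym/eqP; rewrite -subr_eq0 -/v v0.
have ee : e *m e^T = 1%:M.
  rewrite trmx_delta mul_delta_mx; apply/matrixP => j k.
  by rewrite !ord1 !mxE !eqxx.
have ue : u *m e^T = e *m u^T.
  by apply/matrixP => j k; rewrite !ord1 -[in RHS](trmxK e) -trmx_mul [RHS]mxE.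
pose q := fnorm v ^+ 2.
have q0 : q != 0 by rewrite expf_neq0 // gt_eqF // fnorm_row_gt0.
have vv : v *m v^T = q%:M by rewrite [LHS]mx11_scalar -fnorm_row_sqr.
(* Since [u] and [e] have equal norms, [u v^T = - e v^T], whence [q = v v^T = -2 e v^T]. *)
have ev : e *m v^T = (- q / 2)%:M.
  have uv : u *m v^T = - (e *m v^T).
    by rewrite /v linearB /= !mulmxBr uu ee ue opprB.
  have : v *m v^T = - (e *m v^T) - e *m v^T by rewrite {1}/v mulmxBl uv.
  rewrite vv [e *m _]mx11_scalar => /matrixP/(_ 0 0).
  by rewrite !mxE /= !mulr1n => ->; congr _%:M; field.
have -> : u = e + v by rewrite addrC subrK.
(* Only [vv] and [ev] matter now: [vv] makes the symmetric reflection an involution, and [ev] makes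
   it send [e] to [e + v]. *)
clearbody q v; exists (1%:M - (2 / q) *: (v^T *m v)).
  have -> : (1%:M - (2 / q) *: (v^T *m v))^T = 1%:M - (2 / q) *: (v^T *m v).
    by rewrite linearB linearZ /= trmx1 trmx_mul trmxK.
  rewrite mulmxBl mul1mx mulmxBr mulmx1 -scalemxAl -scalemxAr !mulmxA.
  rewrite -(mulmxA v^T v) vv mul_mx_scalar -scalemxAl !scalerA.
  rewrite (_ : 2 / q * (2 / q * q) = 2 / q + 2 / q); last by field.
  by rewrite scalerDl opprB addrK subrK.
rewrite rowE -/e mulmxBr mulmx1 -scalemxAr mulmxA ev mul_scalar_mx scalerA.
rewrite (_ : 2 / q * (- q / 2) = -1); last by field.
by rewrite scaleN1r opprK.
Qed.

Lemma orthogonal_completion_nonneg (R : realType) n (u : 'rV[R]_n) (i : 'I_n)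
    (A : 'M[R]_n) : fnorm u = 1 ->
  exists U : 'M[R]_n, [/\ U *m U^T = 1%:M, row i U = u &
    forall j, j != i -> 0 <= (U *m A *m U^T) i j].
Proof.
move=> /(orthogonal_completion i)[V VV Vi].
pose M := V *m A *m V^T.
(* Entry [(i, j)] of the conjugate becomes [s i * M i j * s j]. As [s i = 1], row [i] of [V] is kept
   and the entry for [j != i] is the absolute value of [M i j]. *)
pose s j : R := if (j != i) && (M i j < 0) then -1 else 1.
exists (diag_mx (\row_j s j) *m V); split.
- rewrite trmx_mul mulmxA -(mulmxA _ V) VV mulmx1 tr_diag_mx mulmx_diag.
  apply/matrixP => j k; rewrite !mxE /s.
  by case: ifP => _; rewrite ?mulrNN mulr1.
- by rewrite -Vi mul_diag_mx; apply/rowP => j; rewrite !mxE /s eqxx mul1r.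
- move=> j ji.
  rewrite trmx_mul tr_diag_mx !mulmxA mul_mx_diag -!mulmxA mul_diag_mx !mulmxA -/M.
  rewrite 2!mxE [X in X * _ * _]mxE [X in _ * X]mxE /s eqxx ji mul1r.
  by case: ltP => Mij; [rewrite mulrN1 oppr_ge0 ltW | rewrite mulr1].
Qed.

(** * The canonical affine change of coordinates *)

Theorem proposition4p1 (R : realType) (p : nat) (hp : (0 < p)%N)
    (a : 'M[R]_p) (b : 'cV[R]_p) (Sigma : 'M[R]_p) (hSigma : Sigma \in unitmx)
    (alpha1 : R) (beta1 : 'rV[R]_p) (hbeta1 : beta1 != 0)
    (d : measure_display) (Omega : measurableType d) (P : probability Omega R)
    (F : R -> set (set Omega)) (hF : filtration F)
    (X W : R -> Omega -> 'cV[R]_p) (x0 : 'cV[R]_p)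
    (hx0 : 0 <= alpha1 + (beta1 *m x0) 0 0)
    (hX0 : {ae P, forall w, X 0 w = x0})
    (hXW : sde_solution P F (fun x => a *m x + b)
       (fun x => Num.sqrt `|alpha1 + (beta1 *m x) 0 0| *: Sigma) X W) :
  exists (K : 'M[R]_p) (l : 'cV[R]_p) (at_ : 'M[R]_p) (bt : 'cV[R]_p)
         (U : 'M[R]_p) (c : R),
    [/\ U *m U^T = 1%:M,
        sde_solution P F (fun x => at_ *m x + bt)
          (fun x => Num.sqrt `|x (Ordinal hp) 0| *: 1%:M)
          (fun t w => K *m X t w + l) (fun t w => U *m W t w),
        0 < c,
        forall t w, 0 <= t ->
          (K *m X t w + l) (Ordinal hp) 0 = c * (alpha1 + (beta1 *m X t w) 0 0)
      & forall j, j != Ordinal hp -> 0 <= at_ (Ordinal hp) j].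

Proof.
pose i0 := Ordinal hp; pose g := beta1 *m Sigma; pose r := (fnorm g)^-1.
have g0 : g != 0.
  apply: contraNneq hbeta1 => gE.
  by rewrite -[beta1]mulmx1 -(mulmxV hSigma) mulmxA -/g gE mul0mx.
have r0 : 0 < r by rewrite invr_gt0 fnorm_row_gt0.
have rg1 : fnorm (r *: g) = 1.
  apply/eqP; rewrite -(@eqrXn2 _ 2) ?fnorm_ge0 // fnorm_row_sqr expr1n.
  rewrite linearZ /= -scalemxAl -scalemxAr scalerA mxE -fnorm_row_sqr.
  by rewrite -expr2 -exprMn mulVf ?expr1n // gt_eqF // fnorm_row_gt0.
(* The conjugate of [a] is the drift matrix of [Sigma^-1 X]; the scalar [r] in [K] does not change
   it, so its conjugate by [U] is the final [at_]. *)
have [U [UU Ui atU]] :=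
  orthogonal_completion_nonneg i0 (invmx Sigma *m a *m Sigma) rg1.
have UtU := mulmx1C UU.
pose K := r *: (U *m invmx Sigma).
pose at_ := U *m (invmx Sigma *m a *m Sigma) *m U^T.
(* Row [i0] of [K] is [r * (r g) Sigma^-1 = r^2 beta1]; this shift supplies the missing
   [r^2 alpha1]. *)
pose l : 'cV[R]_p := (r ^+ 2 * alpha1) *: delta_mx i0 0.
have atK : at_ *m K = K *m a.
  rewrite /at_ /K -scalemxAr -scalemxAl -!mulmxA (mulmxA U^T) UtU mul1mx.
  by rewrite mulmxV // mulmx1.
have KE x : (K *m x + l) i0 0 = r ^+ 2 * (alpha1 + (beta1 *m x) 0 0).
  have -> : (K *m x + l) i0 0 = (row i0 K *m x) 0 0 + l i0 0.
    by rewrite mxE; congr (_ + _); rewrite -row_mul [RHS]mxE.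
  rewrite linearZ /= row_mul Ui -!scalemxAl scalerA -expr2 -(mulmxA beta1) mulmxV //.
  by rewrite mulmx1 !mxE !eqxx mulr1 mulrDr addrC.
(* The constant drift term solves [at_ (K x + l) + bt = K (a x + b)], given [at_ K = K a]. *)
exists K, l, at_, (K *m b - at_ *m l), U, (r ^+ 2); split => //.
- have [_ _ cX _] := hXW; apply: sde_solution_affine hXW => // [x|x|t w i t0].
  + by rewrite !mulmxDr mulmxA atK -mulmxA -addrA [at_ *m l + _]addrC subrK.
  (* Both sides equal [r] times the root of [|V|] times the identity, because
     [K Sigma U^T = r U U^T]. *)
  + rewrite KE normrM sqrtrM // normrX sqrtr_sqr normr_id (gtr0_norm r0).
    rewrite -(scalemxAr _ K Sigma) -!scalemxAl scalerA [_ * r]mulrC.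
    by rewrite -(mulmxA U) mulVmx // mulmx1 UU.
  + by apply: affine_drift_integrable => j; exact: cX.
- by rewrite exprn_gt0.
Qed.
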